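(* Let $\mathcal{H}$ be a real Hilbert space and let $n\ge 2$ be an integer. For each $i\in\{1,\ldots,n\}$, let $F_i:\mathcal{H}\to\mathcal{H}$ be a $\tau_i$-cocoercive mapping, where $\tau_i>0$, and let $(x_{i,k})_{k=0}^{\infty}$ be a sequence in $\mathcal{H}$. Suppose that there exists $(\rho_1,\ldots,\rho_n)\in\mathbb{R}_{++}^n$ such that $$\frac{\sum_{i=1}^n\rho_i\tau_i}{\sum_{i=1}^n\rho_i}\ge 1,$$ and suppose further that, for some $x_1,\ldots,x_n,y\in\mathcal{H}$, as $k\to\infty$, \begin{align*} &\forall i\in\{1,\ldots,n\},\quad x_{i,k}\rightharpoonup x_i,\\ &\forall i\in\{1,\ldots,n\},\quad F_i(x_{i,k})\rightharpoonup y,\\ &\sum_{i=1}^n\rho_i\bigl(x_{i,k}-F_i(x_{i,k})\bigr)\to-\Bigl(\sum_{i=1}^n\rho_i\Bigr)y+\sum_{i=1}^n\rho_ix_i,\\ &\forall i,j\in\{1,\ldots,n\},\quad F_i(x_{i,k})-F_j(x_{j,k})\to 0. \end{align*} Then $F_1(x_1)=F_2(x_2)=\cdots=F_n(x_n)=y$.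
   Context: $\mathbb{R}_{++}=\{r\in\mathbb{R}:r>0\}$. The symbols $\rightharpoonup$ and $\to$ denote weak and strong (norm) convergence in $\mathcal{H}$, respectively. For $\tau>0$, a mapping $T:\mathcal{H}\to\mathcal{H}$ is $\tau$-cocoercive if $\langle x-y,T(x)-T(y)\rangle\ge\tau\|T(x)-T(y)\|^2$ for all $x,y\in\mathcal{H}$. *)

(* Defs.v *)
From HB Require Import structures.
From mathcomp Require Import all_boot all_order all_algebra.
From mathcomp Require Import all_classical all_reals all_analysis.

Set Implicit Arguments.
Unset Strict Implicit.
Unset Printing Implicit Defensive.

Import Order.TTheory GRing.Theory Num.Theory.
Import numFieldNormedType.Exports.

Local Open Scope classical_set_scope.
Local Open Scope ring_scope.

(* A real Hilbert space is given as H : completeNormedModType R together with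
   a symmetric positive definite bilinear form dot : {dot H for idfun} whose
   induced norm is the norm of H, so that the norm topology of H (in which
   [u @ \oo --> l] is strong convergence) is the Hilbert space topology. *)
Definition induces_norm (R : realType) (H : normedModType R)
    (dot : {dot H for idfun}) : Prop :=
  forall x : H, `|x| = Num.sqrt (dot x x).

Definition weak_cvg (R : realType) (H : normedModType R)
    (dot : {dot H for idfun}) (u : nat -> H) (l : H) : Prop :=
  forall z : H, dot (u k) z @[k --> \oo] --> dot l z.

Definition cocoercive (R : realType) (H : normedModType R)
    (dot : {dot H for idfun}) (tau : R) (T : H -> H) : Prop :=
  forall x y : H, tau * `|T x - T y| ^+ 2 <= dot (x - y) (T x - T y).

(* Main.v *)
(* Put [a_i = x_(i,k) - x_i], [q_i = y - F_i(x_i)], fix an index [j], and write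
   [F_i(x_(i,k)) - y = f + e_i] with [f = F_j(x_(j,k)) - y]: [f] and the [a_i]
   tend weakly to 0, the [e_i] strongly. Cocoercivity between [x_(i,k)] and
   [x_i] reads [<a_i, f + e_i + q_i> >= tau_i |f + e_i + q_i|^2]. Weakly
   convergent sequences are bounded, so pairings of weakly with strongly
   convergent ones pass to the limit, and
   [sum rho_i <a_i, f> = (sum rho_i) |f|^2 + o(1)] since
   [sum rho_i (a_i - f)] tends strongly to 0. Summing with weights [rho_i],
     [sum rho_i tau_i |q_i|^2 <= (sum rho_i (1 - tau_i)) |f|^2 + o(1) <= o(1)],
   so every [q_i] is 0. *)
Require Import Defs.
From mathcomp Require Import all_boot all_order all_algebra.
From mathcomp Require Import all_classical all_reals all_analysis.
From mathcomp Require Import ring lra.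
Set Implicit Arguments.
Unset Strict Implicit.
Unset Printing Implicit Defensive.

Import Order.TTheory GRing.Theory Num.Theory.
Import numFieldNormedType.Exports.
Local Open Scope classical_set_scope.
Local Open Scope ring_scope.

Lemma dotC (R : realType) (H : lmodType R) (dot : {dot H for idfun}) (u v : H) :
  dot u v = dot v u.
Proof. by rewrite hermC expr0 mul1r. Qed.

Lemma dotZl (R : realType) (H : lmodType R) (dot : {dot H for idfun})
    (a : R) (u v : H) :
  dot (a *: u) v = a * dot u v.
Proof. exact: linearZl_LR. Qed.

Lemma dotZr (R : realType) (H : lmodType R) (dot : {dot H for idfun})
    (a : R) (u v : H) :
  dot u (a *: v) = a * dot u v.
Proof. exact: linearZr_LR. Qed.

Lemma sqr_norm_dot (R : realType) (H : normedModType R)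
    (dot : {dot H for idfun}) (dot_norm : induces_norm dot) (u : H) :
  `|u| ^+ 2 = dot u u.
Proof.
rewrite dot_norm sqr_sqrtr//.
have [->|u0] := eqVneq u 0; first by rewrite linear0l.
exact/ltW/neq0_dnorm_gt0.
Qed.

Lemma dot_CauchySchwarz (R : realType) (H : normedModType R)
    (dot : {dot H for idfun}) (dot_norm : induces_norm dot) (u v : H) :
  `|dot u v| <= `|u| * `|v|.
Proof.
have [->|v0] := eqVneq v 0; first by rewrite linear0r !normr0 mulr0.
rewrite -(ler_pXn2r (n := 2))// ?nnegrE ?mulr_ge0// exprMn real_normK ?num_real//.
(* The extra factor [|v|^2] avoids dividing: the squared norm of [|v|^2 u - <u,v> v] expands to
   [|v|^2 (|u|^2 |v|^2 - <u,v>^2)]. *)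
rewrite -(ler_pM2r (x := `|v| ^+ 2)) ?exprn_gt0 ?normr_gt0//.
have := sqr_ge0 `| (`|v| ^+ 2) *: u - dot u v *: v|.
rewrite !(sqr_norm_dot dot_norm) linearBl !linearBr.
rewrite /= !dotZl !dotZr (dotC dot v u).
by nra.
Qed.

(* Banach-Steinhaus, applied to the functionals [dot (u k)]. *)
Lemma weak_cvg_bounded (R : realType) (H : completeNormedModType R)
    (dot : {dot H for idfun}) (dot_norm : induces_norm dot)
    (u : nat -> H) (l : H) :
  weak_cvg dot u l -> exists M, forall k, `|u k| <= M.
Proof.
move=> ul.
pose A : set (H -> R^o) := [set dot (u k) | k in setT].
have AP f : A f -> bounded_fun_norm f /\ linear f.
  move=> [k _ <-]; split; last by move=> a v w; rewrite linearPr.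
  move=> r; exists (`|u k| * r) => v vr.
  by rewrite (le_trans (dot_CauchySchwarz dot_norm _ _))// ler_wpM2l.
have Apt : pointwise_bounded A.
  move=> z; have /cvg_seq_bounded[M [_ /(_ (M + 1))]] :
    cvgn (fun k => dot (u k) z) by apply/cvg_ex; exists (dot l z); exact: ul.
  rewrite ltrDl ltr01 => /(_ isT) uM.
  by exists (M + 1) => f [k _ <-]; exact: uM.
have [M AM] := Banach_Steinhauss AP Apt 1.
exists M => k.
(* On the unit ball, the functional of [u k] attains [|u k|] at the normalised [u k]. If [u k = 0],
   evaluating at 0 still yields [0 <= M]. *)
have [->|uk0] := eqVneq (u k) 0.
  have /AM : A (dot (u k)) by exists k.
  by move=> /(_ 0); rewrite normr0 ler01 linear0r normr0; exact.
have /AM/(_ (`|u k|^-1 *: u k)) : A (dot (u k)) by exists k.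
rewrite normrZ normfV normr_id mulVf ?normr_eq0// lexx dotZr.
rewrite -(sqr_norm_dot dot_norm) expr2 mulKf ?normr_eq0// normr_id.
by apply.
Qed.

(** In [<u_k, v_k> = <u_k, v_k - m> + <u_k, m>], the first term is at most [M |v_k - m|] in absolute
    value, where [M] bounds the weakly convergent sequence. *)
Lemma weak_strong_cvg_dot (R : realType) (H : completeNormedModType R)
    (dot : {dot H for idfun}) (dot_norm : induces_norm dot)
    (u v : nat -> H) (l m : H) :
  weak_cvg dot u l -> v k @[k --> \oo] --> m ->
  dot (u k) (v k) @[k --> \oo] --> dot l m.
Proof.
move=> ul vm; have [M uM] := weak_cvg_bounded dot_norm ul.
have -> : (fun k => dot (u k) (v k)) =
    (fun k => dot (u k) (v k - m) + dot (u k) m).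
  by apply/funext => k; rewrite linearBr subrK.
rewrite -[dot l m]add0r; apply: cvgD; last exact: ul.
apply: norm_cvg0.
have vm0 : M * `|v k - m| @[k --> \oo] --> (0 : R).
  rewrite -(mulr0 M) -(@normr0 _ H) -(subrr m).
  by apply: cvgMr; apply: cvg_norm; apply: cvgB => //; exact: cvg_cst.
apply: (squeeze_cvgr _ (cvg_cst 0) vm0).
near=> k; rewrite normr_ge0/= (le_trans (dot_CauchySchwarz dot_norm _ _))//.
by rewrite ler_wpM2r.
Unshelve. all: by end_near. Qed.

Lemma strong_weak_cvg (R : realType) (H : normedModType R)
    (dot : {dot H for idfun}) (dot_norm : induces_norm dot)
    (u : nat -> H) (l : H) :
  u k @[k --> \oo] --> l -> weak_cvg dot u l.
Proof.
move=> ul z; apply/subr_cvg0; apply: norm_cvg0.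
have ul0 : `|u k - l| * `|z| @[k --> \oo] --> (0 : R).
  rewrite -(mul0r `|z|) -(@normr0 _ H) -(subrr l).
  by apply: cvgMl; apply: cvg_norm; apply: cvgB => //; exact: cvg_cst.
apply: (squeeze_cvgr _ (cvg_cst 0) ul0).
near=> k; rewrite normr_ge0/= -linearBl.
exact: dot_CauchySchwarz.
Unshelve. all: by end_near. Qed.

Lemma weak_cvgB (R : realType) (H : normedModType R)
    (dot : {dot H for idfun}) (u : nat -> H) (l : H) :
  weak_cvg dot u l -> weak_cvg dot (fun k => u k - l) 0.
Proof.
move=> ul z; rewrite linear0l.
under eq_fun do rewrite linearBl.
by apply/subr_cvg0; exact: ul.
Qed.

Lemma sum_cvg0 (R : numFieldType) (V : normedModType R) (n : nat)
    (u : 'I_n -> nat -> V) :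
  (forall i, u i k @[k --> \oo] --> 0) ->
  \sum_(i < n) u i k @[k --> \oo] --> 0.
Proof.
move=> u0; rewrite [X in _ --> X](_ : 0 = \sum_(i < n) (0 : V)); last by rewrite big1.
apply: (@cvg_big _ _ +%R) => [|i _]; [exact: add_continuous|exact: u0].
Qed.

(* Here [a] plays the increment of the argument and [f + e + q] that of the
   image; in the application the parenthesised remainder tends to [0]. *)
Lemma cocoercive_split (R : realType) (H : normedModType R)
    (dot : {dot H for idfun}) (tau : R) (a f e q : H) :
  dot a (f + e + q) - tau * dot (f + e + q) (f + e + q) =
  (1 - tau) * dot f f + dot (a - f) f +
  (dot a e + dot a q - tau * (2 * dot f q + 2 * dot f e + 2 * dot q e
    + dot e e)) - tau * dot q q.
Proof.
rewrite !(linearDl, linearDr, linearNl)/=.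
rewrite (dotC dot e f) (dotC dot q f) (dotC dot e q).
by ring.
Qed.

Theorem theorem3p2 (R : realType) (H : completeNormedModType R)
    (dot : {dot H for idfun}) (dot_norm : induces_norm dot)
    (n : nat) (n_ge2 : (2 <= n)%N)
    (F : 'I_n -> H -> H) (tau : 'I_n -> R)
    (tau_gt0 : forall i, 0 < tau i)
    (F_coco : forall i, cocoercive dot (tau i) (F i))
    (xs : 'I_n -> nat -> H)
    (rho : 'I_n -> R) (rho_gt0 : forall i, 0 < rho i)
    (rho_tau : (\sum_(i < n) rho i * tau i) / (\sum_(i < n) rho i) >= 1)
    (x : 'I_n -> H) (y : H)
    (xs_weak : forall i, weak_cvg dot (xs i) (x i))
    (Fxs_weak : forall i, weak_cvg dot (fun k => F i (xs i k)) y)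
    (sum_strong :
      (\sum_(i < n) rho i *: (xs i k - F i (xs i k))) @[k --> \oo]
        --> - ((\sum_(i < n) rho i) *: y) + \sum_(i < n) rho i *: x i)
    (diff_strong : forall i j,
      (F i (xs i k) - F j (xs j k)) @[k --> \oo] --> (0 : H)) :
  forall i, F i (x i) = y.
Proof.
(* The index whose equation is to be proved also serves as the reference index in [f] and [e]. *)
move=> j.
pose a i k := xs i k - x i.
pose f k := F j (xs j k) - y.
pose e i k := F i (xs i k) - F j (xs j k).
pose q i := y - F i (x i).
have a0 i : weak_cvg dot (a i) 0 by exact: weak_cvgB.
have f0 : weak_cvg dot f 0 by exact: (weak_cvgB (Fxs_weak j)).
have e0 i : e i k @[k --> \oo] --> 0 by exact: diff_strong.
have e0w i : weak_cvg dot (e i) 0 by exact: strong_weak_cvg.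
have rho_sum_gt0 : 0 < \sum_(i < n) rho i.
  rewrite (bigD1 j)//= ltr_pwDl// sumr_ge0// => i _; exact/ltW.
have {}rho_tau : \sum_(i < n) rho i * (1 - tau i) <= 0.
  under eq_bigr do rewrite mulrBr mulr1.
  by rewrite sumrB subr_le0 -[leLHS]mul1r -ler_pdivlMr.
pose d k := \sum_(i < n) rho i *: (a i k - f k).
have d0 : d k @[k --> \oo] --> 0.
  (* Termwise, [a_i - f = (xs_i - F_i(xs_i)) - (x_i - y) + e_i], which makes [sum_strong]
     applicable. *)
  have -> : d = fun k =>
      (\sum_(i < n) rho i *: (xs i k - F i (xs i k))
        - (- ((\sum_(i < n) rho i) *: y) + \sum_(i < n) rho i *: x i))
      + \sum_(i < n) rho i *: e i k.
    apply/funext => k; rewrite scaler_suml opprD opprK addrA -!sumrN -!big_split/=.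
    apply: eq_bigr => i _; rewrite -scalerN -!scalerDr; congr (_ *: _).
    by rewrite /a /f /e -(addrA _ y) [RHS]addrAC subrKA (addrC y) addrACA opprD opprK.
  rewrite -[X in _ --> X]addr0; apply: cvgD; first exact/subr_cvg0.
  apply: sum_cvg0 => i; rewrite -(scaler0 _ (rho i)).
  by apply: cvgZr; exact: e0.
(* The remainder of [cocoercive_split]. Each pairing in it has a weakly null factor against a fixed
   or strongly null one; [<f, f>] and [<a_i, f>], which need not converge to 0, are kept out. *)
pose r i k := dot (a i k) (e i k) + dot (a i k) (q i)
  - tau i * (2 * dot (f k) (q i) + 2 * dot (f k) (e i k)
             + 2 * dot (q i) (e i k) + dot (e i k) (e i k)).
have r0 i : r i k @[k --> \oo] --> 0.
  (* The limit is written in the shape of [r], with [a], [f] and [e] replaced by 0, so that the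
     limits combine term by term. *)
  have -> : 0 = dot 0 0 + dot 0 (q i) - tau i * (2 * dot 0 (q i)
    + 2 * dot 0 0 + 2 * dot 0 (q i) + dot 0 0).
    by rewrite !linear0l !(mulr0, addr0, subr0).
  have ae := weak_strong_cvg_dot dot_norm (a0 i) (e0 i).
  have fe := weak_strong_cvg_dot dot_norm f0 (e0 i).
  have ee := weak_strong_cvg_dot dot_norm (e0w i) (e0 i).
  have qe : dot (q i) (e i k) @[k --> \oo] --> dot 0 (q i).
    by under eq_fun do rewrite dotC; exact: e0w.
  apply: cvgB; first by apply: cvgD => //; exact: a0.
  apply: cvgMr; apply: cvgD => //; apply: cvgD; last exact: cvgMr.
  by apply: cvgD; [apply: cvgMr; exact: f0|exact: cvgMr].
pose s k := dot (f k) (d k) + \sum_(i < n) rho i * r i k.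
have s0 : s k @[k --> \oo] --> 0.
  rewrite -[X in _ --> X]addr0; apply: cvgD.
    by rewrite -(linear0l dot 0); exact: weak_strong_cvg_dot.
  apply: sum_cvg0 => i; rewrite -(mulr0 (rho i)).
  by apply: cvgMr; exact: r0.
have coco i k :
    rho i * (tau i * dot (q i) (q i)) <= rho i * (1 - tau i) * dot (f k) (f k)
      + dot (rho i *: (a i k - f k)) (f k) + rho i * r i k.
  have := F_coco i (xs i k) (x i).
  have -> : F i (xs i k) - F i (x i) = f k + e i k + q i.
    by rewrite [f k + _]addrC !subrKA.
  rewrite (sqr_norm_dot dot_norm) -subr_ge0 cocoercive_split => coco.
  rewrite dotZl -mulrA -!mulrDr ler_wpM2l ?(ltW (rho_gt0 i))//.
  by rewrite -subr_ge0.
have bound k : \sum_(i < n) rho i * (tau i * dot (q i) (q i)) <= s k.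
  apply: (le_trans (ler_sum _ (fun i _ => coco i k))).
  (* The sums of [<rho_i (a_i - f), f>] and of the remainders form [s]; what is left is [|f|^2]
     times the nonpositive [sum rho_i (1 - tau_i)]. *)
  rewrite !big_split/= -mulr_suml -linear_sumlz/= lerD2r [leRHS]dotC.
  by rewrite gerDr mulr_le0_ge0// -(sqr_norm_dot dot_norm) exprn_ge0.
(* The left side of [bound] is independent of [k], so the limit of [s] bounds it by 0. *)
have /(cvgr_to_ge s0) : \forall k \near \oo,
    \sum_(i < n) rho i * (tau i * dot (q i) (q i)) <= s k.
  by near=> k; exact: bound.
have term_ge0 i : 0 <= rho i * (tau i * dot (q i) (q i)).
  by rewrite -(sqr_norm_dot dot_norm) !mulr_ge0 ?exprn_ge0// ltW.
rewrite (bigD1 j)//= => sum_le0.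
have : rho j * (tau j * dot (q j) (q j)) <= 0.
  by apply: le_trans sum_le0; rewrite lerDl sumr_ge0.
rewrite pmulr_rle0// pmulr_rle0// -(sqr_norm_dot dot_norm).
by rewrite exprn_even_le0//= normr_eq0 subr_eq0 => /eqP ->.
Unshelve. all: by end_near. Qed.
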